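(* Let $G$ be a connected graph of order $n\geq 3$ with Randić index $R$, algebraic connectivity $a$, diameter $D$ and minimum degree $\delta$. If $D\leq \frac{2(n-3+2\sqrt{2})}{\pi^2}$ or $\delta\geq \frac{n}{2}$, then $$\frac{R}{a}\leq\left(\frac{n-3+2\sqrt{2}}{2}\right)\Big/\left(2\left(1-\cos\frac{\pi}{n}\right)\right).$$
   Context: For a graph $G=(V,E)$, the Randić index is $R(G)=\sum_{uv\in E(G)}\frac{1}{\sqrt{d(u)d(v)}}$, where $d(u)$ is the degree of $u$. The algebraic connectivity $a(G)$ is the second smallest eigenvalue of the Laplacian matrix $L(G)=D(G)-A(G)$ (diagonal degree matrix minus adjacency matrix). The diameter $D$ is the maximum distance between two vertices, and $\delta$ is the minimum vertex degree. *)

(* Defs.v *)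
From HB Require Import structures.
From mathcomp Require Import all_boot all_order all_algebra.
From mathcomp Require Import all_classical all_reals all_analysis.
Set Implicit Arguments. Unset Strict Implicit. Unset Printing Implicit Defensive.
Import Order.TTheory GRing.Theory Num.Theory.
Local Open Scope ring_scope.

Definition simple_graph (n : nat) (e : rel 'I_n) : Prop :=
  symmetric e /\ irreflexive e.

Definition connected_graph (n : nat) (e : rel 'I_n) : Prop :=
  forall u v, connect e u v.

Definition deg (n : nat) (e : rel 'I_n) (u : 'I_n) : nat := #|[set v | e u v]|.

Definition min_deg (n : nat) (e : rel 'I_n) : nat :=
  \big[minn/n]_(u : 'I_n) deg e u.

(* distance: least k such that a walk with k edges goes from u to v
   (returns n if none exists, irrelevant for connected graphs) *)
Definition gdist (n : nat) (e : rel 'I_n) (u v : 'I_n) : nat :=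
  find (fun k => [exists p : k.-tuple 'I_n, path e u p && (last u p == v)])
       (iota 0 n).

Definition diameter (n : nat) (e : rel 'I_n) : nat :=
  (\max_(u : 'I_n) \max_(v : 'I_n) gdist e u v)%N.

(* Randic index: sum over (unordered) edges uv of 1/sqrt(d(u)d(v)),
   computed as half the sum over ordered adjacent pairs. *)
Definition randic (R : realType) (n : nat) (e : rel 'I_n) : R :=
  (\sum_(u : 'I_n) \sum_(v : 'I_n | e u v)
     (Num.sqrt ((deg e u)%:R * (deg e v)%:R))^-1) / 2.

Definition laplacian (R : realType) (n : nat) (e : rel 'I_n) : 'M[R]_n :=
  \matrix_(i, j) ((if i == j then (deg e i)%:R else 0) - (e i j)%:R).

Definition sorted_spectrum (R : realType) (n : nat) (M : 'M[R]_n) (s : seq R) : Prop :=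
  sorted <=%R s /\ char_poly M = \prod_(x <- s) ('X - x%:P).

Definition algebraic_connectivity (R : realType) (n : nat) (e : rel 'I_n) (a : R) : Prop :=
  exists s, sorted_spectrum (laplacian R e) s /\ a = s`_1.

(* Main.v *)
Require Import Defs.
From HB Require Import structures.
From mathcomp Require Import all_boot all_order all_algebra.
From mathcomp Require Import all_classical all_reals all_analysis.
From mathcomp Require Import ring lra.
Import Order.TTheory GRing.Theory Num.Theory.
Import numFieldNormedType.Exports.
Local Open Scope ring_scope.

(* The number 0 is a root of the characteristic polynomial of the Laplacian L
   with eigenvector 1, and every root of the quotient by X has an eigenvector x
   orthogonal to 1; in particular so does a.  Write E for the sum of
   (x_u - x_v)^2 over the edges uv, so that E = a |x|^2.  Cauchy-Schwarz along
   a shortest path gives (x_u - x_v)^2 <= D E, and summing over all ordered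
   pairs (u, v) gives 2 <= n D a.  Comparing G with its complement, whose
   Laplacian is nI - J - L, gives a >= 2 delta - n + 2.  With
   K = n - 3 + 2 sqrt 2, either hypothesis yields pi^2 <= n K a, and the
   theorem follows from R <= n/2 and 1 - cos t <= t^2/2. *)

(** * Trigonometric estimates *)

Lemma sin_le_id {R : realType} (x : R) : 0 <= x -> sin x <= x.
Proof.
move=> x0.
have [|c _] := @MVT_segment R sin cos 0 x x0 (fun y _ => is_derive_sin y).
  by apply: continuous_subspaceT => y; exact: continuous_sin.
rewrite sin0 !subr0 => ->.
by rewrite ler_piMl ?cos_le1.
Qed.

Lemma one_sub_cos {R : realType} (x : R) : 1 - cos x = 2 * sin (x / 2) ^+ 2.
Proof.
have -> : cos x = cos ((x / 2) *+ 2) by congr cos; rewrite -mulr_natr; field.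
by rewrite cos_mulr2n cos2sin2; ring.
Qed.

Lemma one_sub_cos_le {R : realType} (x : R) :
  0 <= x <= pi -> 1 - cos x <= x ^+ 2 / 2.
Proof.
move=> /andP[x0 xpi]; rewrite one_sub_cos.
have s0 : 0 <= sin (x / 2) by apply: sin_ge0_pi; lra.
have sx : sin (x / 2) <= x / 2 by apply: sin_le_id; lra.
have : sin (x / 2) ^+ 2 <= (x / 2) ^+ 2 by rewrite lerXn2r// nnegrE; lra.
lra.
Qed.

Lemma one_sub_cos_gt0 {R : realType} (x : R) : 0 < x <= pi -> 0 < 1 - cos x.
Proof.
move=> /andP[x0 xpi]; rewrite one_sub_cos.
have s0 : 0 < sin (x / 2) by apply: sin_gt0_pi; lra.
by rewrite mulr_gt0 ?exprn_gt0.
Qed.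

(** * Energy of a function on the vertices, paths and the diameter *)

Section Energy.
Context {R : realType} {n : nat} (e : rel 'I_n).
Implicit Types (x : 'I_n -> R) (s p : seq 'I_n).

(* Each edge is counted in both directions, hence twice. *)
Definition energy x : R := \sum_u \sum_(v | e u v) (x u - x v) ^+ 2.

(** For duplicate-free [s] this is the energy of the subgraph induced on [s]. Chords are kept, so
    that it can grow vertex by vertex along a path. *)
Definition energy_on s x : R :=
  \sum_(u <- s) \sum_(v <- s | e u v) (x u - x v) ^+ 2.

Lemma energy_ge0 x : 0 <= energy x.
Proof. by apply: sumr_ge0 => u _; apply: sumr_ge0 => v _; exact: sqr_ge0. Qed.

Lemma energy_on_ge0 s x : 0 <= energy_on s x.
Proof. by apply: sumr_ge0 => u _; apply: sumr_ge0 => v _; exact: sqr_ge0. Qed.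

Lemma energy_on_le s x : uniq s -> energy_on s x <= energy x.
Proof.
move=> us; rewrite /energy_on /energy big_uniq//= big_mkcond/=.
apply: ler_sum => u _; case: ifP => _; last first.
  by apply: sumr_ge0 => v _; exact: sqr_ge0.
rewrite big_mkcond/= big_uniq//= [leLHS]big_mkcond [leRHS]big_mkcond/=.
by apply: ler_sum => v _; case: ifP; case: ifP => // _ _; exact: sqr_ge0.
Qed.

(** The edge from [u] to [w] occurs twice among the new terms, once in the row and once in the
    column of [u], whence the factor 2. *)
Lemma energy_on_cons u w p x : symmetric e -> e u w ->
  2 * (x u - x w) ^+ 2 + energy_on (w :: p) x <= energy_on [:: u, w & p] x.
Proof.
move=> esym euw; rewrite [leRHS]/energy_on big_cons.
have row : (x u - x w) ^+ 2 <=
    \sum_(v <- [:: u, w & p] | e u v) (x u - x v) ^+ 2.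
  (* The diagonal term is 0 whether or not [e u u] holds. *)
  rewrite big_cons big_cons euw subrr expr0n/= add0r if_same lerDl.
  by apply: sumr_ge0 => v _; exact: sqr_ge0.
have col : (x u - x w) ^+ 2 <= \sum_(v <- w :: p | e v u) (x v - x u) ^+ 2.
  rewrite big_cons esym euw -opprB sqrrN lerDl.
  by apply: sumr_ge0 => v _; exact: sqr_ge0.
have -> : \sum_(v <- w :: p) \sum_(t <- [:: u, w & p] | e v t) (x v - x t) ^+ 2
  = \sum_(v <- w :: p | e v u) (x v - x u) ^+ 2 + energy_on (w :: p) x.
  rewrite [X in _ = X + _]big_mkcond -big_split/=; apply: eq_bigr => v _.
  by rewrite [LHS]big_cons; case: ifP; rewrite ?add0r.
lra.
Qed.

(** By induction on the path: Cauchy-Schwarz merges the increment over the first edge with the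
    increment over the rest. *)
Lemma path_energy_on u p x : symmetric e -> path e u p ->
  2 * (x u - x (last u p)) ^+ 2 <= (size p)%:R * energy_on (u :: p) x.
Proof.
move=> esym; elim: p u => [|w p IH] u /=.
  by rewrite subrr expr0n/= mulr0 mul0r.
move=> /andP[euw /IH]; have := energy_on_cons u w p x esym euw.
have := energy_on_ge0 (w :: p) x.
set S := energy_on (w :: p) x; set S' := energy_on _ x.
set k := size p; set z := x (last w p).
move=> S0 SS H.
have -> : x u - z = (x u - x w) + (x w - z) by ring.
move: H; set b := x w - z; move: SS; set a := x u - x w => SS H.
apply: le_trans (_ : (k%:R + 1) * (2 * a ^+ 2 + S) <= _); last first.
  by rewrite natr1 ler_wpM2l.
(* The identity below is multiplied by [K], so length 0 is treated apart; there the induction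
   hypothesis forces [b = 0]. *)
move: H; have [->|k0] := posnP k.
  rewrite mul0r => H; have b0 : b = 0.
    by apply/eqP; rewrite -sqrf_eq0; apply/eqP; have := sqr_ge0 b; lra.
  by rewrite b0; lra.
have K1 : 1 <= k%:R :> R by rewrite ler1n.
move: K1; set K := k%:R => K1 H.
(* Cauchy-Schwarz step; the identity below is its defect, multiplied by [K]. *)
rewrite -(ler_pM2l (lt_le_trans ltr01 K1)) -subr_ge0.
have -> : K * ((K + 1) * (2 * a ^+ 2 + S)) - K * (2 * (a + b) ^+ 2)
  = (K + 1) * (K * S - 2 * b ^+ 2) + 2 * (K * a - b) ^+ 2 by ring.
by rewrite addr_ge0// mulr_ge0 ?sqr_ge0 ?subr_ge0//; lra.
Qed.

(** Cutting out loops keeps the ends, does not lengthen the path and makes it duplicate-free, so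
    that no pair is counted repeatedly. *)
Lemma path_energy u p x : symmetric e -> path e u p ->
  2 * (x u - x (last u p)) ^+ 2 <= (size p)%:R * energy x.
Proof.
move=> esym /shortenP[p' pp' up' sub].
apply: le_trans (path_energy_on _ _ _ esym pp') _.
apply: ler_pM; rewrite ?energy_on_ge0 ?energy_on_le//.
by rewrite ler_nat uniq_leq_size//; case/andP: up'.
Qed.

(** A duplicate-free path has fewer than [n] edges, so the search through [iota 0 n] succeeds
    instead of returning its default. *)
Lemma gdist_path u v : connect e u v ->
  exists p, [/\ path e u p, last u p = v & size p = gdist e u v].
Proof.
move=> /connectP[p ep vE].
move: vE; case/shortenP: ep => p' ep' up' _ vE.
have sp : (size p' < n)%N.
  have := uniq_leq_size up' (fun i _ => mem_enum 'I_n i).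
  by rewrite size_enum_ord.
pose f := (fun k => [exists p : k.-tuple 'I_n, path e u p && (last u p == v)]).
have hf : has f (iota 0 n).
  apply/hasP; exists (size p'); first by rewrite mem_iota.
  by apply/existsP; exists (in_tuple p'); rewrite ep' vE eqxx.
have := nth_find 0%N hf; move: (hf); rewrite has_find size_iota => fn.
rewrite nth_iota// add0n => /existsP[q /andP[eq /eqP qv]].
by exists q; split => //; rewrite size_tuple.
Qed.

Lemma gdist_le_diameter u v : (gdist e u v <= diameter e)%N.
Proof.
rewrite /diameter (bigD1 u)//= (bigD1 v)//=.
by rewrite -maxnA leq_max leqnn.
Qed.

Lemma energy_diameter u v x : symmetric e -> connected_graph e ->
  2 * (x u - x v) ^+ 2 <= (diameter e)%:R * energy x.
Proof.
move=> esym /(_ u v)/gdist_path[p [ep <- sp]].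
apply: le_trans (path_energy _ _ _ esym ep) _.
by rewrite ler_wpM2r ?energy_ge0// ler_nat sp gdist_le_diameter.
Qed.

Lemma sum_sqr_pairs x : \sum_u x u = 0 ->
  \sum_u \sum_v (x u - x v) ^+ 2 = 2 * n%:R * \sum_u x u ^+ 2.
Proof.
move=> x0.
under eq_bigr => u _.
  under eq_bigr => v _.
    have -> : (x u - x v) ^+ 2 = x u ^+ 2 + x v ^+ 2 - 2 * x u * x v by ring.
    over.
  rewrite sumrB big_split/= -[X in _ - X]mulr_sumr x0 mulr0 subr0.
  rewrite sumr_const card_ord.
  over.
by rewrite big_split/= sumr_const card_ord sumrMnl -mulr_natl; ring.
Qed.

(** Sum the diameter bound over all ordered pairs and cancel one factor [n]; this cancellation is
    why [n = 0] is treated apart. *)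
Lemma energy_poincare x : symmetric e -> connected_graph e -> \sum_u x u = 0 ->
  4 * \sum_u x u ^+ 2 <= n%:R * (diameter e)%:R * energy x.
Proof.
move=> esym conn x0; set D := (diameter e)%:R * energy x.
have [n0|n0] := posnP n.
  rewrite big1 ?mulr0 ?(mulr_ge0, energy_ge0)// => u _.
  by have := ltn_ord u; rewrite [X in (_ < X)%N]n0.
have : \sum_u \sum_v 2 * (x u - x v) ^+ 2 <= \sum_(u < n) \sum_(v < n) D.
  by apply: ler_sum => u _; apply: ler_sum => v _; exact: energy_diameter.
under eq_bigr do rewrite -mulr_sumr.
rewrite -mulr_sumr sum_sqr_pairs// !sumr_const card_ord.
rewrite -[leRHS]mulr_natl -[D *+ n]mulr_natl => h.
by rewrite -mulrA -/D -(@ler_pM2l _ n%:R) ?ltr0n//; lra.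
Qed.

Lemma sum_deg (f : 'I_n -> R) :
  \sum_u \sum_(v | e u v) f u = \sum_u (deg e u)%:R * f u.
Proof.
apply: eq_bigr => u _; rewrite sumr_const mulr_natl; congr (_ *+ _).
by rewrite /deg cardsE.
Qed.

Lemma sum_deg_sym (f : 'I_n -> R) : symmetric e ->
  \sum_u \sum_(v | e u v) f v = \sum_u (deg e u)%:R * f u.
Proof.
move=> esym; rewrite -sum_deg (exchange_big_dep xpredT)//=.
by apply: eq_bigr => u _; apply: eq_bigl => v; rewrite esym.
Qed.

(** From (a - b)^2 <= 2 a^2 + 2 b^2. Applied to the complement, it will turn large degrees into a
    lower bound for the energy. *)
Lemma energy_le_deg x : symmetric e ->
  energy x <= 4 * \sum_u (deg e u)%:R * x u ^+ 2.
Proof.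
move=> esym.
apply: le_trans
  (_ : \sum_u \sum_(v | e u v) (2 * x u ^+ 2 + 2 * x v ^+ 2) <= _).
  apply: ler_sum => u _; apply: ler_sum => v _.
  by have := sqr_ge0 (x u + x v); rewrite !expr2; lra.
under eq_bigr do rewrite big_split/=.
pose f u := 2 * x u ^+ 2.
rewrite big_split/= (sum_deg f) (sum_deg_sym f)// -big_split/= mulr_sumr.
by apply: ler_sum => u _; rewrite /f; lra.
Qed.

(** The quadratic form of the Laplacian counts each edge once and [energy] counts it twice. *)
Lemma laplacian_energy x : symmetric e -> irreflexive e ->
  2 * \sum_u \sum_v x u * laplacian R e u v * x v = energy x.
Proof.
move=> esym eirr.
have -> : energy x = \sum_u \sum_(v | e u v) (x u ^+ 2 + x v ^+ 2)
   - 2 * \sum_u \sum_(v | e u v) x u * x v.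
  rewrite /energy mulr_sumr -sumrB; apply: eq_bigr => u _.
  by rewrite mulr_sumr -sumrB; apply: eq_bigr => v _; ring.
under [X in _ = X - _]eq_bigr do rewrite big_split/=.
pose f u := x u ^+ 2.
rewrite big_split/= (sum_deg f) (sum_deg_sym f)// {}/f.
have -> : \sum_u \sum_v x u * laplacian R e u v * x v =
  \sum_u (deg e u)%:R * x u ^+ 2 - \sum_u \sum_(v | e u v) x u * x v.
  rewrite -sumrB; apply: eq_bigr => u _.
  rewrite [X in _ = _ - X]big_mkcond/=.
  have -> : (deg e u)%:R * x u ^+ 2 =
      \sum_v (if u == v then (deg e u)%:R * x u * x v else 0) :> R.
    rewrite -big_mkcond/= (big_pred1 u) => [|v]; [ring|exact: eq_sym].
  rewrite -sumrB; apply: eq_bigr => v _; rewrite mxE.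
  by case: eqP => _; case: (e u v) => /=; ring.
ring.
Qed.

End Energy.

(** * Splitting the eigenvalue 0 off the characteristic polynomial *)

Lemma mulmx_const1 {K : pzSemiRingType} {k : nat} (A : 'M[K]_(k, 1)) :
  A *m const_mx 1 = A.
Proof.
rewrite (_ : const_mx 1 = 1%:M) ?mulmx1//.
by apply/matrixP => i j; rewrite !mxE !ord1.
Qed.

Section Spectrum.
Context {F : fieldType} {m : nat} (M : 'M[F]_(1 + m)).
Hypothesis M1 : M *m const_mx 1 = 0 :> 'cV_(1 + m).

Lemma col1_mx (K : pzSemiRingType) :
  const_mx 1 = col_mx (const_mx 1) (const_mx 1) :> 'cV[K]_(1 + m).
Proof. by rewrite col_mx_const. Qed.

(* Adding all columns of ['X%:M - M] to the first one turns it into ['X]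
   times the all-ones column; [deflated_mx] is the result without the
   factor ['X]. *)
Definition deflated_mx : 'M[{poly F}]_(1 + m) :=
  row_mx (const_mx 1) (rsubmx (char_poly_mx M)).

Lemma char_poly_deflated : char_poly M = 'X * \det deflated_mx.
Proof.
set C := char_poly_mx M.
have C1 : C *m const_mx 1 = 'X *: const_mx 1 :> 'cV_(1 + m).
  have -> : const_mx 1 = map_mx polyC (const_mx 1 : 'cV[F]_(1 + m)).
    by rewrite map_const_mx.
  by rewrite /C/char_poly_mx mulmxBl -map_mxM M1 map_mx0 subr0 mul_scalar_mx.
(* The left block matrix has determinant 1 and adds all columns to the first; the right one
   multiplies the first column by ['X]. *)
have E : C *m block_mx (1%:M : 'M[{poly F}]_1) 0
                       (const_mx 1) (1%:M : 'M[{poly F}]_m) =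
         deflated_mx *m block_mx ('X%:M : 'M[{poly F}]_1) 0
                                 0 (1%:M : 'M[{poly F}]_m).
  move: C1; rewrite /deflated_mx -/C -{1 2}(hsubmxK C).
  rewrite {1}col1_mx mul_row_col !mul_row_block.
  rewrite !mulmx0 !mulmx1 !add0r !addr0 mul_mx_scalar.
  by rewrite mulmx_const1 => ->.
have := congr1 determinant E; rewrite !det_mulmx !det_lblock !det1 !mulr1.
by rewrite det_scalar1 mulrC.
Qed.

(** Take [v] in the left kernel of the deflated matrix at [b]. Its first column gives orthogonality
    to 1, the others kill all columns of [v *m (b%:M - M)] but the first. The first vanishes too,
    since the columns of [b%:M - M] add up to [b] times the all-ones column. *)
Lemma root_deflated (b : F) : root (\det deflated_mx) b ->
  exists v : 'rV_(1 + m), [/\ v != 0, v *m const_mx 1 = 0 :> 'cV_1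
    & v *m M = b *: v].
Proof.
rewrite /root -horner_evalE -det_map_mx => /det0P[v v0 vN]; exists v.
have Cb : map_mx (horner_eval b) (char_poly_mx M) = b%:M - M.
  apply/matrixP => i j; rewrite !mxE /horner_eval hornerD hornerN hornerMn.
  by rewrite hornerX hornerC.
move: vN; rewrite /deflated_mx map_row_mx map_const_mx map_rsubmx Cb.
rewrite mul_mx_row -[X in _ = X -> _]row_mx0 => /eq_row_mx[].
rewrite rmorph1 => v1 vr; split => //.
apply/eqP; rewrite -subr_eq0 -mul_mx_scalar -mulmxBr -oppr_eq0 -mulmxN opprB.
set B := b%:M - M; apply/eqP.
have : v *m (B *m const_mx 1) = 0 :> 'cV_1.
  by rewrite /B mulmxBl M1 subr0 mul_scalar_mx -scalemxAr v1 scaler0.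
rewrite -{1}[B]hsubmxK col1_mx mul_row_col mulmxDr.
rewrite [v *m (rsubmx B *m _)]mulmxA vr mul0mx addr0.
by rewrite mulmx_const1 => vl; rewrite -[B]hsubmxK mul_mx_row vl vr row_mx0.
Qed.

End Spectrum.

(** * The complement graph and the minimum degree *)

Section Fiedler.
Context {R : realType} {n : nat} (e : rel 'I_n).

Lemma laplacian_const_mx :
  laplacian R e *m const_mx 1 = 0 :> 'cV_n.
Proof.
apply/matrixP => u j; rewrite !mxE.
under eq_bigr do rewrite !mxE mulr1.
rewrite sumrB -big_mkcond/= (big_pred1 u) => [|v]; last exact: eq_sym.
rewrite -natr_sum; by rewrite /deg cardsE -sum1_card big_mkcond/= subrr.
Qed.

Definition compl_rel : rel 'I_n := fun u v => (u != v) && ~~ e u v.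

Lemma compl_rel_sym : symmetric e -> symmetric compl_rel.
Proof. by move=> esym u v; rewrite /compl_rel eq_sym esym. Qed.

Lemma deg_compl u : irreflexive e -> (deg e u + deg compl_rel u).+1 = n.
Proof.
move=> eirr; rewrite /deg.
have := cardsC [set v | e u v]; rewrite card_ord => /(etrans _); apply.
rewrite -addnS; congr (_ + _)%N.
rewrite (cardsD1 u (~: _)) !inE eirr /= add1n; congr S; apply: eq_card => v.
by rewrite !inE /compl_rel eq_sym.
Qed.

Lemma energy_compl (x : 'I_n -> R) : irreflexive e ->
  energy e x + energy compl_rel x = \sum_u \sum_v (x u - x v) ^+ 2.
Proof.
move=> eirr; rewrite -big_split/=; apply: eq_bigr => u _.
rewrite [X in X + _]big_mkcond [X in _ + X]big_mkcond -big_split/=.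
apply: eq_bigr => v _; rewrite /compl_rel.
have [->|_] := eqVneq u v; first by rewrite eirr/= addr0 subrr expr0n.
by case: (e u v); rewrite /= ?addr0 ?add0r.
Qed.

(** The two energies add up to 2 n S, with S the sum of squares, and complement degrees are at most
    n - 1 - d, so the complement takes at most 4 (n - 1 - d) S. *)
Lemma energy_min_deg (x : 'I_n -> R) (d : R) :
  symmetric e -> irreflexive e -> \sum_u x u = 0 ->
  (forall u, d <= (deg e u)%:R) ->
  2 * (2 * d - n%:R + 2) * \sum_u x u ^+ 2 <= energy e x.
Proof.
move=> esym eirr x0 dle.
have := energy_compl x eirr; rewrite sum_sqr_pairs//.
have := energy_le_deg compl_rel x (compl_rel_sym esym).
have : \sum_u (deg compl_rel u)%:R * x u ^+ 2 <=
    \sum_u (n%:R - 1 - d) * x u ^+ 2.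
  apply: ler_sum => u _; rewrite ler_wpM2r ?sqr_ge0//.
  have /(congr1 (fun k => k%:R : R)) := deg_compl u eirr.
  by rewrite -natr1 natrD; have := dle u; lra.
rewrite -mulr_sumr; set S := \sum_u x u ^+ 2.
set T := \sum_u _; lra.
Qed.

Lemma min_deg_le u : (min_deg e <= deg e u)%N.
Proof. exact: (@bigmin_le _ nat _ n u (deg e)). Qed.

End Fiedler.

(** * Eigenvectors orthogonal to the constants *)

Lemma deflated_root_gt0 {R : realType} {m : nat} (e : rel 'I_(1 + m))
    (b : R) :
  simple_graph e -> connected_graph e ->
  root (\det (deflated_mx (laplacian R e))) b ->
  0 < b /\ exists x : 'I_(1 + m) -> R,
    [/\ \sum_u x u = 0, 0 < \sum_u x u ^+ 2
      & energy e x = 2 * b * \sum_u x u ^+ 2].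
Proof.
move=> [esym eirr] conn /(root_deflated _ (laplacian_const_mx e)).
move=> [v [v0 v1 vL]]; pose x u := v 0 u.
have x1 : \sum_u x u = 0.
  have /matrixP/(_ 0 0) := v1; rewrite !mxE => vs; rewrite -[RHS]vs.
  by apply: eq_bigr => u _; rewrite mxE mulr1.
have x2 : 0 < \sum_u x u ^+ 2.
  have [u vu] : exists u, v 0 u != 0.
    by apply/existsP; apply: contraR v0 => /existsPn h; apply/eqP/rowP => u;
       rewrite mxE; apply/eqP; have := h u; rewrite negbK.
  rewrite (bigD1 u)//= ltr_pwDl//; first by rewrite exprn_even_gt0.
  by apply: sumr_ge0 => w _; exact: sqr_ge0.
have xE : energy e x = 2 * b * \sum_u x u ^+ 2.
  rewrite -laplacian_energy// -mulrA; congr (_ * _).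
  rewrite exchange_big mulr_sumr; apply: eq_bigr => w _ /=.
  rewrite -mulr_suml; have /rowP/(_ w) := vL; rewrite !mxE => ->.
  by rewrite -mulrA.
split; last by exists x.
(* Connectedness enters here: for [b <= 0] the right-hand side would be nonpositive, while 4 [S] is
   positive. *)
have := energy_poincare e x esym conn x1; rewrite xE.
set S := \sum_u x u ^+ 2 in x2 *; set D := (diameter e)%:R => h.
have : 0 < (1 + m)%:R * D * (2 * b * S).
  by apply: lt_le_trans h; rewrite mulr_gt0.
apply: contraTT; rewrite -!leNgt => b0.
rewrite mulr_ge0_le0 ?mulr_ge0 ?ler0n//.
by rewrite mulr_le0_ge0 ?(ltW x2)//; lra.
Qed.

(** It suffices that the second entry of the spectrum is a root of the deflated determinant [q]. If
    the least entry [s0] is 0, cancel ['X]. Otherwise 0 comes later, so [s0 <= 0]; being nonzero,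
    [s0] would be a root of [q], hence positive. *)
Lemma fiedler_vector {R : realType} {n : nat} (e : rel 'I_n) (a : R) :
  (1 < n)%N -> simple_graph e -> connected_graph e ->
  algebraic_connectivity e a ->
  0 < a /\ exists x : 'I_n -> R,
    [/\ \sum_u x u = 0, 0 < \sum_u x u ^+ 2
      & energy e x = 2 * a * \sum_u x u ^+ 2].
Proof.
case: n e => [|m] e // m1 eS conn [s [[s_sorted charE] aE]].
have key := fun b : R => deflated_root_gt0 e b eS conn.
suff: root (\det (deflated_mx (laplacian R e))) a by move/key.
move: charE; rewrite (char_poly_deflated _ (laplacian_const_mx e)).
set q := \det _ in key *; move=> charE.
(* Ensures that the entry of index 1 is a genuine eigenvalue and not the default 0. *)
have sz : size s = m.+1.
  have := char_poly_deflated _ (laplacian_const_mx (R := R) e).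
  rewrite charE => /(congr1 (size : {poly R} -> nat)).
  by rewrite size_char_poly size_prod_XsubC => -[].
case: s s_sorted charE aE sz => [|s0 [|s1 s]]//=; first by
  move=> _ _ _ [m0]; rewrite -m0 in m1.
move=> s_sorted charE -> _.
have s0_min := order_path_min le_trans (s_sorted : path <=%O s0 (s1 :: s)).
have root_q : s0 = 0 -> root q s1.
  move=> s0E; move: charE; rewrite s0E big_cons subr0.
  by move=> /(mulfI (negbT (polyX_eq0 R))) ->; rewrite root_prod_XsubC mem_head.
have : root (\prod_(x <- [:: s0, s1 & s]) ('X - x%:P)) 0.
  by rewrite -charE rootM rootX eqxx.
rewrite root_prod_XsubC inE => /predU1P[/esym//|/(allP s0_min) s0_le0].
have := root_prod_XsubC [:: s0, s1 & s] s0.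
rewrite -charE mem_head rootM rootX => /orP[/eqP//|/key[]].
by rewrite ltNge s0_le0.
Qed.

(** * Upper bound for the Randić index *)

Lemma inv_sqrt_mul_le {R : realType} (a b : R) : 0 <= a -> 0 <= b ->
  (Num.sqrt (a * b))^-1 <= (a^-1 + b^-1) / 2.
Proof.
move=> a0 b0; rewrite sqrtrM// invfM.
have sq (c : R) : 0 <= c -> c^-1 = (Num.sqrt c)^-1 ^+ 2.
  by move=> c0; rewrite exprVn sqr_sqrtr.
rewrite (sq a)// (sq b)//.
by have := sqr_ge0 ((Num.sqrt a)^-1 - (Num.sqrt b)^-1); rewrite !expr2; lra.
Qed.

Lemma randic_ge0 {R : realType} {n : nat} (e : rel 'I_n) : 0 <= randic R e.
Proof.
rewrite /randic mulr_ge0//; apply: sumr_ge0 => u _; apply: sumr_ge0 => v _.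
by rewrite invr_ge0 sqrtr_ge0.
Qed.

(** By the AM-GM bound on each edge, a vertex of positive degree d receives d shares of 1/d in the
    doubled sum, that is, 1. *)
Lemma randic_le {R : realType} {n : nat} (e : rel 'I_n) :
  symmetric e -> randic R e <= n%:R / 2.
Proof.
move=> esym; rewrite /randic ler_wpM2r ?invr_ge0//.
pose f u : R := (deg e u)%:R^-1 / 2.
apply: le_trans (_ : \sum_u \sum_(v | e u v) (f u + f v) <= _).
  apply: ler_sum => u _; apply: ler_sum => v _.
  by rewrite -mulrDl inv_sqrt_mul_le.
under eq_bigr do rewrite big_split/=.
rewrite big_split/= sum_deg sum_deg_sym// -big_split/=.
apply: le_trans (_ : \sum_(u < n) 1 <= _); last by rewrite sumr_const card_ord.
(* An isolated vertex contributes 0, the inverse of 0 being 0. *)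
apply: ler_sum => u _; rewrite /f; have [->|d0] := eqVneq (deg e u)%:R (0 : R).
  by rewrite !mul0r addr0.
by rewrite mulrA divff//; lra.
Qed.

Theorem theorem2p7 (R : realType) (n : nat) (e : rel 'I_n) (a : R) :
  (3 <= n)%N -> simple_graph e -> connected_graph e ->
  algebraic_connectivity e a ->
  ((diameter e)%:R <= 2 * (n%:R - 3 + 2 * Num.sqrt 2) / (pi : R) ^+ 2
   \/ n%:R / 2 <= (min_deg e)%:R :> R) ->
  randic R e / a <= ((n%:R - 3 + 2 * Num.sqrt 2) / 2) / (2 * (1 - cos (pi / n%:R))).
Proof.
move=> n3 eS conn ac hyp; have [esym eirr] := eS.
have [a0 [x [x1 x2 xE]]] := fiedler_vector e a (ltnW n3) eS conn ac.
have N3 : 3 <= n%:R :> R by rewrite ler_nat.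
set N : R := n%:R in N3 hyp *.
have r2 : 7 / 5 <= Num.sqrt 2 :> R.
  have := sqr_sqrtr (ler0n R 2); have := sqrtr_ge0 (2 : R); nra.
set K := N - 3 + 2 * Num.sqrt 2 in hyp *.
have K2 : 14 / 5 <= K by rewrite /K; lra.
have pi0 := pi_gt0 R; have pi4 : pi <= 4 :> R by have := pihalf_lt2 R; lra.
have piK : pi ^+ 2 <= N * K * a.
  case: hyp => [Dle|dle].
  (* Here [h] reads 4 <= 2 n D a; multiply it by pi^2 and insert D pi^2 <= 2 K. *)
  - have := energy_poincare e x esym conn x1; rewrite xE mulrA ler_pM2r// => h.
    rewrite ler_pdivlMr ?exprn_gt0// in Dle.
    have Na : 0 <= N * a by rewrite mulr_ge0//; lra.
    have := ler_wpM2l Na Dle; have := ler_wpM2r (sqr_ge0 (pi : R)) h.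
    rewrite -/N; lra.
  - have dle' u : N / 2 <= (deg e u)%:R.
      by apply: le_trans dle _; rewrite ler_nat min_deg_le.
    have := energy_min_deg e x _ esym eirr x1 dle'.
    rewrite xE ler_pM2r// -/N => h.
    (* Crude constants suffice: pi^2 <= 16 = 8 * 2 <= N K a. *)
    have a2 : 2 <= a by lra.
    have p16 : pi ^+ 2 <= 4 ^+ 2 :> R by rewrite lerXn2r ?nnegrE//; lra.
    have NK : 8 <= N * K by nra.
    by apply: le_trans p16 _; nra.
have N0 : 0 < N by lra.
have xpi : 0 < pi / N <= pi.
  by rewrite divr_gt0//= ler_pdivrMr// ler_peMr ?ltW//; lra.
have c0 := one_sub_cos_gt0 _ xpi.
have cle : 1 - cos (pi / N) <= (pi / N) ^+ 2 / 2.
  by apply: one_sub_cos_le; case/andP: xpi => /ltW-> ->.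
set c := 1 - cos _ in c0 cle *.
rewrite ler_pdivlMr ?mulr_gt0// mulrAC ler_pdivrMr//.
(* The goal is now [randic R e * (2 * c) <= K / 2 * a]; the middle term equals pi^2 / (2 N). *)
apply: le_trans (_ : N / 2 * (2 * ((pi / N) ^+ 2 / 2)) <= _).
  by apply: ler_pM => //; [exact: randic_ge0 | lra | exact: randic_le | lra].
have -> : N / 2 * (2 * ((pi / N) ^+ 2 / 2)) = pi ^+ 2 / N / 2.
  by field; lra.
have : pi ^+ 2 / N <= K * a by rewrite ler_pdivrMr//; lra.
lra.
Qed.
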